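(* Let $R$ be a normal commutative unital ring with stable rank one. Let $A, B$ be countably generated projective $R$-modules, and let $I, J$ be pure ideals of $R$ that are countably generated projective as $R$-modules, such that $A \oplus I \precsim B \oplus J$ and $J \prec I$. Then $A$ is isomorphic to a pure submodule of $B$.
   Context: A unital ring $R$ has stable rank one if for all $a,b\in R$ with $Ra+Rb=R$ there is $y\in R$ with $R(a+yb)=R$. A ring $R$ is left normal if whenever $a,b,c\in R$ satisfy $ba=a$ and $cb=b$, there are $d,e\in R$ with $da=a$, $ed=d$, $ce=e$; right normal is the analogous condition with the products in opposite order; normal means left and right normal (for commutative rings these conditions coincide). For $R$-modules $P,Q$: $P\precsim Q$ means that for every finitely generated submodule $X$ of $P$ there are module homomorphisms $\phi\colon X\to Q$ and $\psi\colon Q\to P$ such that $\psi\circ\phi$ is the inclusion $X\hookrightarrow P$. $P\prec Q$ means that there is a finitely generated submodule $Y$ of $Q$ such that for every finitely generated submodule $X$ of $P$ there are such $\phi,\psi$ with, in addition, $\phi(X)\subseteq Y$. A submodule $N$ of an $R$-module $M$ is pure if for every $R$-module $X$ the map $N\otimes_R X\to M\otimes_R X$ induced by inclusion is injective. (When $M$ is projective this is equivalent to: for every finitely generated submodule $F\subseteq N$ there is a homomorphism $\sigma\colon M\to N$ with $\sigma|_F=\mathrm{id}_F$.) A pure ideal of $R$ is an ideal that is a pure submodule of $R$. *)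

(* Defs.v *)
From HB Require Import structures.
From mathcomp Require Export all_boot all_algebra.
From mathcomp Require Import generic_quotient ring_quotient.
From mathcomp Require Import boolp classical_sets cardinality.
From mathcomp Require Import freeg.

Set Implicit Arguments.
Unset Strict Implicit.
Unset Printing Implicit Defensive.

Import GRing.Theory.
Local Open Scope ring_scope.
Local Open Scope quotient_scope.

(* Unital rings are [pzRingType]s rather than [nzRingType]s so as not to      *)
(* exclude the zero ring.                                                     *)

Section Rings.
Variable R : pzRingType.

Definition stable_rank_one :=
  forall a b : R,
    (forall z, exists r s, z = r * a + s * b) ->
    exists y, forall z, exists r, z = r * (a + y * b).

Definition left_normal :=
  forall a b c : R, b * a = a -> c * b = b ->
    exists d e : R, [/\ d * a = a, e * d = d & c * e = e].

Definition right_normal :=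
  forall a b c : R, a * b = a -> b * c = b ->
    exists d e : R, [/\ a * d = a, d * e = d & e * c = e].

Definition normal_ring := left_normal /\ right_normal.

End Rings.

(* A submodule of M is a [submodClosed M], that is, a boolean predicate       *)
(* closed under 0, addition and scaling; classically every submodule is of    *)
(* this form.  [submod N] is N regarded as a module in its own right, with    *)
(* inclusion [submod_val : submod N -> M].  An ideal of a commutative ring R  *)
(* is a [submodClosed R^o].                                                   *)

Section Submodules.
Variables (R : pzRingType) (M : lmodType R) (N : submodClosed M).

Record submod := Submod { submod_val : M; _ : submod_val \in N }.

HB.instance Definition _ := [isSub for submod_val].
HB.instance Definition _ := [Choice of submod by <:].
HB.instance Definition _ := [SubChoice_isSubLmodule of submod by <:].

Lemma submod_val_is_linear : linear submod_val.
Proof. exact: (linearP (\val : submod -> M)). Qed.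

HB.instance Definition _ :=
  GRing.isLinear.Build R submod M *:%R submod_val submod_val_is_linear.

End Submodules.

Arguments submod {R M} N.
Arguments submod_val {R M N} _.

Section Modules.
Variable R : pzRingType.

(* S is the least submodule of M containing G. *)
Definition generates (M : lmodType R) (G : set M) (S : {pred M}) :=
  (forall x, G x -> x \in S) /\
  forall T : submodClosed M,
    (forall x, G x -> x \in T) -> {subset S <= T}.

Definition fin_gen (M : lmodType R) (S : {pred M}) :=
  exists2 G : set M, finite_set G & generates G S.

Definition countably_generated (M : lmodType R) :=
  exists2 G : set M, countable G & generates G (predT : {pred M}).

Definition projective (P : lmodType R) :=
  forall (E F : lmodType R) (g : {linear E -> F}) (f : {linear P -> F}),
    (forall y, exists x, g x = y) ->
    exists h : {linear P -> E}, forall x, g (h x) = f x.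

Definition precsim (P Q : lmodType R) :=
  forall X : submodClosed P, fin_gen X ->
    exists (phi : {linear submod X -> Q}) (psi : {linear Q -> P}),
      forall x, psi (phi x) = submod_val x.

Definition prec (P Q : lmodType R) :=
  exists2 Y : submodClosed Q, fin_gen Y &
  forall X : submodClosed P, fin_gen X ->
    exists (phi : {linear submod X -> Q}) (psi : {linear Q -> P}),
      (forall x, psi (phi x) = submod_val x) /\ (forall x, phi x \in Y).

Definition module_iso (M N : lmodType R) :=
  exists f : {linear M -> N}, bijective f.

End Modules.

(* The tensor product over a commutative ring R, as an abelian group: the     *)
(* quotient of the free abelian group on N * X by the subgroup generated by   *)
(* the biadditivity and balancing relators.                                   *)

Section Tensor.
Variable R : comPzRingType.

Section Object.
Variables N X : lmodType R.

Local Notation F := {freeg (N * X)%type / int}.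
Local Notation "n ** x" := (<< (n, x) >> : F) (at level 40).

Inductive tensor_relator : F -> Prop :=
| TensorAddl n n' x : tensor_relator ((n + n') ** x - n ** x - n' ** x)
| TensorAddr n x x' : tensor_relator (n ** (x + x') - n ** x - n ** x')
| TensorBal a n x : tensor_relator ((a *: n) ** x - n ** (a *: x)).

Definition tensor_null : {pred F} := fun u =>
  `[< forall T : zmodClosed F,
        (forall v, tensor_relator v -> v \in T) -> u \in T >].

Lemma tensor_nullP u :
  reflect (forall T : zmodClosed F,
             (forall v, tensor_relator v -> v \in T) -> u \in T)
          (u \in tensor_null).
Proof. exact: asboolP. Qed.

Lemma tensor_null_closed : zmod_closed tensor_null.
Proof.
split; first by apply/tensor_nullP=> T _; exact: rpred0.
move=> u v /tensor_nullP uN /tensor_nullP vN; apply/tensor_nullP=> T TN.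
by apply: rpredB; [exact: uN|exact: vN].
Qed.

HB.instance Definition _ :=
  GRing.isZmodClosed.Build F tensor_null tensor_null_closed.

Definition tensor : zmodType := {ideal_quot tensor_null}.

Definition tensor_pi (u : F) : tensor := \pi_({ideal_quot tensor_null}) u.

Definition tensor_repr (t : tensor) : F := repr (t : {ideal_quot tensor_null}).

Definition tens (n : N) (x : X) : tensor := tensor_pi (n ** x).

Lemma tensor_piP u v :
  reflect (tensor_pi u = tensor_pi v) (u - v \in tensor_null).
Proof. by rewrite Quotient.idealrBE; exact: eqP. Qed.

Lemma tensor_reprK t : tensor_pi (tensor_repr t) = t.
Proof. exact: reprK. Qed.

Lemma tensor_pi_is_zmod_morphism : zmod_morphism tensor_pi.
Proof. exact: pi_is_zmod_morphism. Qed.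

HB.instance Definition _ :=
  GRing.isZmodMorphism.Build F tensor tensor_pi tensor_pi_is_zmod_morphism.

End Object.

Lemma fglift_is_zmod_morphism (K : choiceType) (V : lmodType int) (f : K -> V) :
  zmod_morphism (fglift f : {freeg K / int} -> V).
Proof. exact: lift_is_additive. Qed.

(* The map N (x) X -> M (x) X induced by f : N -> M, defined on a             *)
(* representative; [tensor_map_pi] is the independence of that choice.        *)
Section Functor.
Variables (N M : lmodType R) (f : {linear N -> M}) (X : lmodType R).

Definition free_map (u : {freeg (N * X)%type / int}) :
    {freeg (M * X)%type / int} :=
  fglift (fun p => << (f p.1, p.2) >>) u.

HB.instance Definition _ :=
  GRing.isZmodMorphism.Build _ _ free_map (@fglift_is_zmod_morphism _ _ _).

Definition tensor_map (t : tensor N X) : tensor M X :=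
  tensor_pi (free_map (tensor_repr t)).

Lemma free_mapU n x : free_map << (n, x) >> = << (f n, x) >>.
Proof. by rewrite /free_map liftU scale1r. Qed.

Lemma free_mapB : {morph free_map : u v / u - v}.
Proof. exact: raddfB. Qed.

Lemma free_map_null u : u \in @tensor_null N X -> free_map u \in @tensor_null M X.
Proof.
move=> /tensor_nullP uN; apply/tensor_nullP => T TN.
pose S : {pred {freeg (N * X)%type / int}} := fun v => free_map v \in T.
have SE v : (v \in S) = (free_map v \in T) by rewrite unfold_in.
have SC : zmod_closed S.
  split; first by rewrite SE raddf0 rpred0.
  by move=> v w; rewrite !SE raddfB => vT wT; exact: rpredB.
pose HS := GRing.isZmodClosed.Build _ S SC.
pose S' : zmodClosed _ := HB.pack S HS.
rewrite -SE; apply: (uN S') => v ruv; rewrite SE.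
case: ruv => [n n' x|n x x'|a n x].
- by rewrite !free_mapB !free_mapU raddfD; exact/TN/TensorAddl.
- by rewrite !free_mapB !free_mapU; exact/TN/TensorAddr.
- by rewrite !free_mapB !free_mapU linearZ; exact/TN/TensorBal.
Qed.

Lemma tensor_map_pi u : tensor_map (tensor_pi u) = tensor_pi (free_map u).
Proof.
apply/tensor_piP; rewrite -raddfB; apply: free_map_null.
by apply/tensor_piP; rewrite tensor_reprK.
Qed.

Lemma tensor_map_tens n x : tensor_map (tens n x) = tens (f n) x.
Proof. by rewrite tensor_map_pi free_mapU. Qed.

Lemma tensor_map_is_zmod_morphism : zmod_morphism tensor_map.
Proof.
move=> s t; rewrite -[s]tensor_reprK -[t]tensor_reprK -raddfB.
by rewrite !tensor_map_pi !raddfB.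
Qed.

End Functor.

Definition pure (M : lmodType R) (N : submodClosed M) :=
  forall X : lmodType R,
    injective (tensor_map (X := X) (submod_val : {linear submod N -> M})).

End Tensor.

(* Main.v *)
Require Import Defs.
From HB Require Import structures.
From mathcomp Require Import generic_quotient ring_quotient freeg.
From mathcomp Require Import boolp classical_sets functions cardinality ring.

(** There are two steps.

    First, the ideals cancel: every finite subset of [A] is mapped into [B] by
    some linear map with a left inverse on that subset. As [J] factors through
    a finitely generated part of the pure ideal [I], some [w] in [I] acts as the
    identity on [J] ([prec_ideal_unit]). Restricted to the submodule generated
    by finitely many elements of [A] and by [w], the comparison of [A * I] with
    [B * J] is a matrix whose last column is almost unimodular: it becomes so
    once [1 - w] is added to one entry, and [1 - w] annihilates [J]. Stable rank
    one turns that entry into a unit, which serves as a pivot to eliminate the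
    ideals ([cancel_ideal]). Pure ideals enter only through their local units:
    finitely many elements of a pure ideal are fixed by a single element of it
    ([pure_common_unit]).

    Second, these local splittings are assembled into one map. Being countably
    generated and projective, [A] has a dual basis indexed by the natural numbers
    ([projective_dual_basis]), hence endomorphisms of finite rank that fix any
    prescribed finite subset. Stable rank one of the matrix rings over [R]
    ([stable_rank_one_mx]) implies that two local splittings of [A] in [B] differ
    on a given finite subset by an automorphism of [B] ([exchange]). So one can
    choose splittings on larger and larger finite subsets, each of which agrees
    with the previous one where that one is split; in the limit this gives an injective map from
    [A] to [B] that has a left inverse on every finite subset, and such a map has
    a pure image ([pure_embedding]). *)

Set Implicit Arguments.
Unset Strict Implicit.
Unset Printing Implicit Defensive.

Import GRing.Theory.
Local Open Scope ring_scope.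

(** * Stable rank one of matrices *)

Section MatrixStableRank.
Variable R : comPzRingType.

(** One instance of the stable range condition for matrices, for the row
    [(a | b)] rather than for a column because the maps that matrices encode
    below act on row vectors. *)
Definition stable_at n m (a : 'M[R]_n) (b : 'M[R]_(n, m)) :=
  (exists s t, a *m s + b *m t = 1%:M) ->
  exists y c, (a + b *m y) *m c = 1%:M.

(** The condition is insensitive to invertible operations on the rows of [a]
    and [b], on the columns of [a], and to adding combinations of the columns
    of [b] to [a]: such operations transport both the unimodularity relation
    and its solution. *)
Lemma stable_at_op n m (a : 'M[R]_n) (b : 'M[R]_(n, m)) (k : 'M_(m, n))
    (g g' h h' : 'M_n) :
  g *m g' = 1%:M -> g' *m g = 1%:M -> h *m h' = 1%:M -> h' *m h = 1%:M ->
  stable_at (h *m (a *m g + b *m k)) (h *m b) -> stable_at a b.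
Proof.
move=> gg' g'g hh' h'h ab [s [t st1]].
have [] := ab.
  exists (g' *m s *m h'), ((t - k *m g' *m s) *m h').
  rewrite -!mulmxA -mulmxDr !mulmxA -mulmxDl !mulmxDl mulmxBr !mulmxA.
  rewrite -[a *m g *m g']mulmxA gg' mulmx1 mulmxBl addrAC -addrA subrK.
  by rewrite -mulmxDl st1 mul1mx.
move=> y [c yc1]; exists ((k + y) *m g'), (g *m c *m h).
have E : (a + b *m ((k + y) *m g')) *m g = a *m g + b *m k + b *m y.
  by rewrite [LHS]mulmxDl -!mulmxA g'g mulmx1 mulmxDr addrA.
rewrite -[g *m c *m h]mulmxA mulmxA E mulmxA -[X in X *m h]mul1mx -{1}h'h.
rewrite -(mulmxA h') [h *m _]mulmxA.
by rewrite [h *m _]mulmxDr [h *m (b *m y)]mulmxA yc1 mulmx1.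
Qed.

Lemma stable_at_block n m (a : 'M[R]_n) (b : 'M[R]_(1 + n, m)) :
  stable_at a (dsubmx b) -> stable_at (block_mx 1%:M 0 0 a) b.
Proof.
move=> ab [s [t st1]]; have [] := ab.
  exists (drsubmx s), (rsubmx t).
  have := congr1 drsubmx st1.
  rewrite -{1}[s]submxK -{1}[b]vsubmxK -{1}[t]hsubmxK.
  rewrite mulmx_block mul_col_row add_block_mx block_mxKdr scalar_mx_block.
  by rewrite block_mxKdr mul0mx add0r.
move=> y [c yc1]; exists (row_mx 0 y).
exists (block_mx 1%:M (- (usubmx b *m y *m c)) 0 c).
rewrite -{1}[b]vsubmxK mul_col_row add_block_mx mulmx_block.
rewrite !(mulmx0, mul0mx, mul1mx, mulmx1, addr0, add0r) addNr yc1.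
by rewrite scalar_mx_block.
Qed.

(** A unit in the corner of [a] clears the rest of its first row by column
    operations, then the rest of its first column by row operations, and leaves
    a problem of smaller size. *)
Lemma stable_at_corner n m (a : 'M[R]_(1 + n)) (b : 'M[R]_(1 + n, m)) u :
  (forall a' b', @stable_at n m a' b') -> a 0 0 * u = 1 -> stable_at a b.
Proof.
move=> IHn au1; have ua1 : u * a 0 0 = 1 by rewrite mulrC.
pose g : 'M_(1 + n) := block_mx u%:M (- u *: ursubmx a) 0 1%:M.
pose g' : 'M_(1 + n) := block_mx (a 0 0)%:M (ursubmx a) 0 1%:M.
pose h x : 'M[R]_(1 + n) := block_mx 1%:M 0 (x *: dlsubmx a) 1%:M.
have aE : ulsubmx a = (a 0 0)%:M.
  by rewrite [LHS]mx11_scalar !mxE !lshift0.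
apply: (@stable_at_op _ _ a b 0 g g' (h (- u)) (h u)).
- rewrite mulmx_block scalar_mx_block; congr block_mx.
  + by rewrite mulmx0 addr0 -scalar_mxM ua1.
  + by rewrite mul_scalar_mx mulmx1 scaleNr subrr.
  + by rewrite mul0mx mulmx0 addr0.
  + by rewrite mul0mx mulmx1 add0r.
- rewrite mulmx_block scalar_mx_block; congr block_mx.
  + by rewrite mulmx0 addr0 -scalar_mxM au1.
  + by rewrite mul_scalar_mx mulmx1 scalerA mulrN au1 scaleN1r addNr.
  + by rewrite mul0mx mulmx0 addr0.
  + by rewrite mul0mx mulmx1 add0r.
- rewrite mulmx_block scalar_mx_block !mulmx1 !mul1mx.
  rewrite !mulmx0 !mul0mx !addr0 !add0r.
  by rewrite -scalerDl addNr scale0r.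
- rewrite mulmx_block scalar_mx_block !mulmx1 !mul1mx.
  rewrite !mulmx0 !mul0mx !addr0 !add0r.
  by rewrite -scalerDl subrr scale0r.
rewrite mulmx0 addr0 -{1}[a]submxK !mulmx_block aE.
rewrite !mulmx1 !mulmx0 !mul1mx !mul0mx !addr0 -!scalar_mxM au1 mul_scalar_mx.
rewrite !(mulmx1, mulmx0, mul1mx, mul0mx, addr0).
rewrite scalerA mulrN au1 scaleN1r addNr mulmx0 add0r mul_mx_scalar scaleNr addNr.
exact: stable_at_block.
Qed.

(** Stable rank one passes to matrices. Unimodularity of the first row of
    [(a | b)] and stable rank one of the ring make the corner entry of [a]
    a unit after column operations, and induction does the rest. *)
Lemma stable_rank_one_mx (R_sr1 : stable_rank_one R) n m
    (a : 'M[R]_n) (b : 'M[R]_(n, m)) :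
  stable_at a b.
Proof.
elim: n a b => [|n IHn] a b.
  by move=> _; exists 0, 0; apply/matrixP => -[].
move: a b; rewrite -[n.+1]/(1 + n)%N => a b.
move=> st; have [s [t st1]] := st.
pose c := ursubmx a *m dlsubmx s + usubmx b *m lsubmx t.
have c1 : a 0 0 * s 0 0 + c 0 0 = 1.
  have := congr1 (fun M => ulsubmx M 0 0) st1.
  rewrite -{1}[a]submxK -{1}[s]submxK -{1}[b]vsubmxK -{1}[t]hsubmxK.
  rewrite mulmx_block mul_col_row add_block_mx block_mxKul scalar_mx_block block_mxKul.
  by rewrite -addrA -/c mxE [X in X + _]mxE big_ord1 !mxE !lshift0.
(* [c 0 0] collects what the other entries of the first row contribute to the
   relation; adding [y] times it to the corner is a column operation. *)
have [|y /(_ 1) [u' u1]] := R_sr1 (a 0 0) (c 0 0).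
  by move=> z; exists (z * s 0 0), z; rewrite -mulrA -mulrDr [s _ _ * _]mulrC c1 mulr1.
pose g x : 'M[R]_(1 + n) := block_mx 1%:M 0 (x *: dlsubmx s) 1%:M.
apply: (@stable_at_op _ _ a b (row_mx (y *: lsubmx t) 0) (g y) (g (- y)) 1%:M 1%:M) st.
- rewrite mulmx_block scalar_mx_block !mulmx1 !mul1mx.
  rewrite !mulmx0 !mul0mx !addr0 !add0r.
  by rewrite -scalerDl subrr scale0r.
- rewrite mulmx_block scalar_mx_block !mulmx1 !mul1mx.
  rewrite !mulmx0 !mul0mx !addr0 !add0r.
  by rewrite -scalerDl addNr scale0r.
- exact: mul1mx.
- exact: mul1mx.
apply: (@stable_at_corner _ _ _ _ u') => //; rewrite [LHS]mulrC [RHS]u1; congr (_ * _).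
rewrite -[in LHS](submxK a) -[in LHS](vsubmxK b) mulmx_block mul_col_row add_block_mx.
have corner (M : 'M[R]_(1 + n)) : M 0 0 = ulsubmx M 0 0.
  by rewrite !mxE !lshift0.
rewrite corner mul1mx block_mxKul mulmx1 -!scalemxAr -addrA -scalerDr -/c.
by rewrite mxE -corner [X in _ + X]mxE.
Qed.

End MatrixStableRank.

(** * Comparing partial splittings *)

Section LinearOf.
Variables (R : pzRingType) (U V : lmodType R) (f : U -> V) (f_lin : linear f).

Definition linear_of : {linear U -> V} :=
  HB.pack f (GRing.isLinear.Build R U V *:%R f f_lin).

End LinearOf.

(** Any two partially split maps from [A] to [B] differ by an automorphism of
    [B], as far as a map of finite rank on [A] can see. Write [theta] for the
    map of finite rank given by [a] and [f]. Then [T := 1 + (phi' - phi) theta psi]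
    already carries [phi x] to [phi' x], and [S := 1 + (phi - phi') theta psi']
    undoes it there; so [T + y (1 - S T)] agrees with [T] on [phi x] for every
    [y], and stable rank one provides a [y] that makes it invertible.
    All these maps have the form [1 + U m V] with [V : B -> R^2k] and
    [U : R^2k -> B] fixed and [m] a matrix; [1 + U m V] has a left inverse as
    soon as the matrix [1 + W m] has a right one, where [W] is the matrix of
    [V U]. So stable rank one is needed for matrices only. *)
Lemma exchange (R : comPzRingType) (R_sr1 : stable_rank_one R)
    (A B : lmodType R) k (a : 'I_k -> A) (f : 'I_k -> {linear A -> R^o})
    (phi phi' : {linear A -> B}) (psi psi' : {linear B -> A}) :
  exists g g' : {linear B -> B}, cancel g g' /\
    forall x, \sum_i f i x *: a i = x -> psi (phi x) = x -> psi' (phi' x) = x ->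
    g (phi x) = phi' x.
Proof.
pose p x : 'rV[R]_k := \row_i f i x.
have p_lin : linear p.
  by move=> c x y; apply/rowP=> i; rewrite !mxE linearP.
pose V b : 'rV[R]_(k + k) := row_mx (p (psi b)) (p (psi' b)).
have V_lin : linear V.
  by move=> c x y; rewrite /V !linearP !p_lin scale_row_mx add_row_mx.
pose U (v : 'rV[R]_(k + k)) : B :=
  \sum_i lsubmx v 0 i *: phi (a i) + \sum_i rsubmx v 0 i *: phi' (a i).
have U_lin : linear U.
  move=> c v w; rewrite /U scalerDr !scaler_sumr addrACA.
  by congr (_ + _); rewrite -big_split; apply: eq_bigr => i _ /=;
    rewrite !mxE scalerDl scalerA.
pose W := lin1_mx (linear_of V_lin \o linear_of U_lin).
have WE v : v *m W = V (U v) by rewrite mul_rV_lin1.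
(* In the notation above, [m1] and [m2] are the matrices of [T] and [S], and
   [m3] is that of [S T]; products are reversed because rows are acted upon
   from the right. *)
pose m1 : 'M[R]_(k + k) := block_mx (- 1%:M) 1%:M 0 0.
pose m2 : 'M[R]_(k + k) := block_mx 0 0 1%:M (- 1%:M).
have m1E u v : row_mx u v *m m1 = row_mx (- u) u.
  by rewrite mul_row_block mulmxN !mulmx1 !mulmx0 !addr0.
have m2E u v : row_mx u v *m m2 = row_mx v (- v).
  by rewrite mul_row_block mulmxN !mulmx1 !mulmx0 !add0r.
pose m3 := m1 + m2 + m1 *m W *m m2.
have [] := @stable_rank_one_mx R R_sr1 _ _ (1%:M + W *m m1) (- (W *m m3)).
  exists (1%:M + W *m m2), 1%:M.
  rewrite mulmx1 mulmxDr mulmx1 mulmxDl mul1mx /m3 !mulmxDr !mulmxA -!addrA.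
  by rewrite [X in 1%:M + X](_ : _ = 0) ?addr0 // !addrA subrr.
move=> y [c yc1].
pose n := m1 - m3 *m y.
have nc1 : (1%:M + W *m n) *m c = 1%:M.
  by rewrite /n mulmxBr addrA mulmxA -mulNmx.
pose g b := b + U (V b *m n).
pose g' b := b - U (V b *m n *m c).
have g_lin : linear g.
  move=> r b b'; rewrite /g V_lin mulmxDl -scalemxAl U_lin.
  by rewrite [r *: (b + _)]scalerDr addrACA.
have g'_lin : linear g'.
  move=> r b b'; rewrite /g' V_lin !mulmxDl -!scalemxAl U_lin [r *: (b - _)]scalerBr.
  by rewrite opprD addrACA.
exists (linear_of g_lin), (linear_of g'_lin); split.
  move=> b /=; rewrite /g' /g.
  have -> : V (b + U (V b *m n)) = V b + V b *m n *m W.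
    by rewrite WE -[b]scale1r V_lin !scale1r.
  have -> : (V b + V b *m n *m W) *m n = V b *m n *m (1%:M + W *m n).
    by rewrite mulmxDl [RHS]mulmxDr mulmx1 !mulmxA.
  by rewrite -[_ *m _ *m c]mulmxA nc1 mulmx1 addrK.
move=> x fax pphi pphi' /=; rewrite /g.
have sumE (h : {linear A -> B}) : \sum_i p x 0 i *: h (a i) = h x.
  rewrite -[in RHS]fax linear_sum; apply: eq_bigr => i _.
  by rewrite linearZ mxE.
have UE : U (row_mx (- p x) (p x)) = phi' x - phi x.
  rewrite /U row_mxKl row_mxKr sumE addrC; congr (_ + _).
  by rewrite -sumE -sumrN; apply: eq_bigr => i _; rewrite mxE scaleNr.
have V1 : V (phi x) = row_mx (p x) (p (psi' (phi x))) by rewrite /V pphi.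
have V2 : V (phi' x) = row_mx (p (psi (phi' x))) (p x) by rewrite /V pphi'.
have VE : V (phi x) *m m1 *m W = V (phi' x) - V (phi x).
  rewrite WE V1 m1E UE -V1 -[phi' x]scale1r -scaleN1r addrC V_lin.
  by rewrite scaleN1r addrC scale1r.
suff -> : V (phi x) *m n = row_mx (- p x) (p x).
  by rewrite UE addrC subrK.
rewrite mulmxBr {1}V1 m1E [X in _ - X](_ : _ = 0) ?subr0 //.
rewrite mulmxA [X in X *m y](_ : _ = 0) ?mul0mx //.
rewrite /m3 !mulmxDr !mulmxA VE mulmxBl -addrA [_ + (_ - _)]addrC subrK.
by rewrite V1 V2 m1E m2E add_row_mx addNr subrr row_mx0.
Qed.

(** * Pure ideals and pure submodules *)

Lemma submodB (R : pzRingType) (M : lmodType R) (N : submodClosed M) (x y : M) :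
  x \in N -> y \in N -> x - y \in N.
Proof. by move=> xN yN; rewrite -scaleN1r rpredD // rpredZ. Qed.

Section QuotientModule.
Local Open Scope quotient_scope.
Variables (R : comPzRingType) (x : R).

Definition multiples : {pred R^o} := fun y => `[< exists r, y = r * x >].

Lemma multiplesP y : reflect (exists r, y = r * x) (y \in multiples).
Proof. exact: asboolP. Qed.

Lemma multiples_zmod_closed : zmod_closed multiples.
Proof.
split; first by apply/multiplesP; exists 0; rewrite mul0r.
move=> _ _ /multiplesP[r ->] /multiplesP[s ->].
by apply/multiplesP; exists (r - s); rewrite mulrBl.
Qed.

HB.instance Definition _ :=
  GRing.isZmodClosed.Build R^o multiples multiples_zmod_closed.

Definition quot_by := {ideal_quot multiples}.
HB.instance Definition _ := GRing.Zmodule.on quot_by.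

Definition quot_pi (r : R) : quot_by := \pi_({ideal_quot multiples}) r.
Definition quot_repr (c : quot_by) : R := repr (c : {ideal_quot multiples}).

Lemma quot_reprK c : quot_pi (quot_repr c) = c.
Proof. exact: reprK. Qed.

Lemma quot_piP r s : reflect (quot_pi r = quot_pi s) (r - s \in multiples).
Proof. by rewrite Quotient.idealrBE; exact: eqP. Qed.

Lemma quot_piD : {morph quot_pi : r s / r + s}.
Proof. exact: (raddfD (\pi_({ideal_quot multiples}))). Qed.

Lemma quot_pi0 : quot_pi 0 = 0.
Proof. exact: (raddf0 (\pi_({ideal_quot multiples}))). Qed.

Definition quot_scale (r : R) (c : quot_by) : quot_by := quot_pi (r * quot_repr c).

Lemma quot_scale_pi r s : quot_scale r (quot_pi s) = quot_pi (r * s).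
Proof.
apply/quot_piP; rewrite -mulrBr.
have /quot_piP/multiplesP[q ->] : quot_pi (quot_repr (quot_pi s)) = quot_pi s.
  exact: quot_reprK.
by apply/multiplesP; exists (r * q); rewrite mulrA.
Qed.

Lemma quot_scaleA r s c : quot_scale r (quot_scale s c) = quot_scale (r * s) c.
Proof. by rewrite -[c]quot_reprK !quot_scale_pi mulrA. Qed.

Lemma quot_scale1 : left_id 1 quot_scale.
Proof. by move=> c; rewrite -[c]quot_reprK quot_scale_pi mul1r. Qed.

Lemma quot_scaleDr : right_distributive quot_scale +%R.
Proof.
move=> r c d; rewrite -[c]quot_reprK -[d]quot_reprK -quot_piD.
by rewrite !quot_scale_pi mulrDr quot_piD.
Qed.

Lemma quot_scaleDl c : {morph quot_scale^~ c : r s / r + s}.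
Proof.
by move=> r s; rewrite -[c]quot_reprK !quot_scale_pi mulrDl quot_piD.
Qed.

HB.instance Definition _ := GRing.Zmodule_isLmodule.Build R quot_by
  quot_scaleA quot_scale1 quot_scaleDr quot_scaleDl.

Lemma quot_reprD c d :
  exists q, quot_repr (c + d) = quot_repr c + quot_repr d + q * x.
Proof.
have /quot_piP/multiplesP[q qE] :
    quot_pi (quot_repr (c + d)) = quot_pi (quot_repr c + quot_repr d).
  by rewrite quot_piD !quot_reprK.
by exists q; rewrite -qE [RHS]addrC subrK.
Qed.

Lemma quot_reprZ r c : exists q, quot_repr (r *: c) = r * quot_repr c + q * x.
Proof.
have /quot_piP/multiplesP[q qE] :
    quot_pi (quot_repr (r *: c)) = quot_pi (r * quot_repr c).
  by rewrite quot_reprK.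
by exists q; rewrite -qE [RHS]addrC subrK.
Qed.

End QuotientModule.

HB.instance Definition _ (R : comPzRingType) (N M : lmodType R)
    (f : {linear N -> M}) (X : lmodType R) :=
  GRing.isZmodMorphism.Build (tensor N X) (tensor M X) (tensor_map f (X := X))
    (@tensor_map_is_zmod_morphism R N M f X).

Lemma tensZl (R : comPzRingType) (N X : lmodType R) (r : R) (n : N) (x : X) :
  tens (r *: n) x = tens n (r *: x).
Proof.
by apply/tensor_piP/tensor_nullP => T; apply; exact: TensorBal.
Qed.

Lemma tensDr (R : comPzRingType) (N X : lmodType R) (n : N) (x y : X) :
  tens n (x + y) = tens n x + tens n y.
Proof.
rewrite /tens -raddfD; apply/tensor_piP/tensor_nullP => T TT.
by rewrite opprD addrA; apply/TT/TensorAddr.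
Qed.

Lemma tens0r (R : comPzRingType) (N X : lmodType R) (n : N) :
  tens n (0 : X) = 0.
Proof. by apply: (addrI (tens n 0)); rewrite -tensDr !addr0. Qed.

(** Tensoring the inclusion of [J] with [R / (x)] sends [x (x) 1] to
    [1 (x) x = 0], so purity gives [x (x) 1 = 0] in [J (x) R / (x) = J / x J],
    that is, [x] lies in [x J]. The map from the tensor product to [J / x J] is
    replaced by the subgroup of the free abelian group on which it vanishes. *)
Lemma pure_local_unit (R : comPzRingType) (J : submodClosed R^o) (x : R) :
  pure J -> x \in J -> exists2 e : R, e \in J & e * x = x.
Proof.
move=> J_pure xJ.
pose X : lmodType R := quot_by x.
pose one : X := quot_pi x 1.
pose x' : submod J := Submod xJ.
have t0 : tens x' one = 0.
  apply: (J_pure X); rewrite raddf0 [LHS]tensor_map_tens /=.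
  have xE : x = x *: (1 : R^o) :> R^o by rewrite [RHS]mulr1.
  rewrite [X in tens X _]xE tensZl [_ *: one](_ : _ = 0) ?tens0r //.
  rewrite /one [LHS]quot_scale_pi -(quot_pi0 x); apply/quot_piP.
  by rewrite subr0; apply/multiplesP; exists 1; rewrite mulr1 mul1r.
have /tensor_piP/tensor_nullP x'T :
    tensor_pi << (x', one) >> = tensor_pi (0 : {freeg (submod J * X)%type / int}).
  by rewrite raddf0.
pose h (p : submod J * X) : R := submod_val p.1 * quot_repr p.2.
pose hh : {freeg (submod J * X)%type / int} -> R := fglift (h : _ -> zmodule R).
have hhB : zmod_morphism hh := fglift_is_zmod_morphism (h : _ -> zmodule R).
have hhU p : hh << p >> = h p by rewrite /hh liftU scale1r.
(* [hh] depends on the representatives only up to an element of [x J]. *)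
pose inJx (r : R) := exists2 e, e \in J & r = e * x.
pose T : {pred {freeg (submod J * X)%type / int}} := fun u => `[< inJx (hh u) >].
have T_closed : zmod_closed T.
  split.
    apply/asboolP; exists 0; first exact: rpred0.
    by rewrite -{1}(subrr 0) hhB subrr mul0r.
  move=> u v /asboolP[d dJ du] /asboolP[e eJ ev]; apply/asboolP.
  exists (d - e); first exact: submodB.
  by rewrite hhB du ev mulrBl.
pose TM := GRing.isZmodClosed.Build _ T T_closed.
pose T' : zmodClosed _ := HB.pack T TM.
have TT v : tensor_relator v -> v \in T'.
  case=> [n n' c|n c c'|r n c]; apply/asboolP; rewrite !hhB !hhU /h /=.
  - by exists 0; [exact: rpred0 | ring].
  - have [q ->] := quot_reprD c c'.
    exists (submod_val n * q); last ring.
    by rewrite mulrC; apply: rpredZ; exact: valP.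
  - have [q ->] := quot_reprZ r c.
    have vZ : r *: submod_val n = r * submod_val n by [].
    exists (- (submod_val n * q)); last by rewrite vZ; ring.
    rewrite -mulNr mulrC; apply: rpredZ.
    by rewrite -[X in X \in _]scaleN1r rpredZ //; exact: valP.
have /asboolP[e eJ] : <<(x', one)>> - 0 \in T' := x'T T' TT.
rewrite subr0 hhU /h /= => xe.
have /quot_piP/multiplesP[q qE] : quot_pi x (quot_repr one) = quot_pi x 1.
  exact: quot_reprK.
exists (e - q * x); first by apply: submodB => //; apply: rpredZ.
by rewrite mulrBl -xe -(subrK 1 (quot_repr one)) qE; ring.
Qed.

Lemma pure_common_unit (R : comPzRingType) (J : submodClosed R^o) (s : seq R) :
  pure J -> {subset s <= J} -> exists2 e : R, e \in J & {in s, forall x, e * x = x}.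
Proof.
move=> J_pure; elim: s => [|x s IHs] sJ; first by exists 0 => //; exact: rpred0.
have [|e eJ es] := IHs; first by move=> y ys; rewrite sJ // inE ys orbT.
have [d dJ dx] := pure_local_unit J_pure (sJ x (mem_head x s)).
(* [1 - (d + e - d * e)] is the product of [1 - d] and [1 - e]. *)
exists (d + e - d * e).
  by apply: submodB; [exact: rpredD | exact: rpredZ].
have E y : (d + e - d * e) * y = d * y + e * y - d * (e * y) by ring.
move=> y; rewrite inE E => /predU1P[->|ys].
  by rewrite mulrCA dx addrK.
by rewrite es // addrAC subrr add0r.
Qed.

Lemma free_map_coefU (R : comPzRingType) (N M X : lmodType R)
    (f : {linear N -> M}) k p :
  @free_map R N M f X << k *g p >> = << k *g (f p.1, p.2) >>.
Proof.
case: p => n x; rewrite -[k]intz -!freegU_mulz raddfMz.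
by congr (_ *~ _); exact: free_mapU.
Qed.

(** An element of the tensor product involves finitely many elements of [N]; a
    map that retracts [M] onto them retracts its image back to it. *)
Lemma locally_split_pure (R : comPzRingType) (M : lmodType R) (N : submodClosed M) :
  (forall s : seq (submod N), exists sigma : {linear M -> submod N},
      {in s, forall x, sigma (submod_val x) = x}) ->
  pure N.
Proof.
move=> N_split X t t' tt'.
pose u := tensor_repr t; pose u' := tensor_repr t'.
have [sigma sK] := N_split (map fst (dom u ++ dom u')).
have retract v : {subset map fst (dom v) <= map fst (dom u ++ dom u')} ->
    tensor_map sigma (tensor_map (X := X)
      (submod_val : {linear submod N -> M}) (tensor_pi v)) = tensor_pi v.
  move=> vs; rewrite !tensor_map_pi; congr tensor_pi.
  rewrite -[v]freeg_sumE !raddf_sum; apply: eq_big_seq => z zv /=.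
  rewrite !free_map_coefU /= sK -?surjective_pairing //.
  by apply: vs; rewrite map_f.
rewrite -[t]tensor_reprK -[t']tensor_reprK -[tensor_pi _]retract; last first.
  by move=> n; rewrite map_cat mem_cat => ->.
rewrite tensor_reprK tt' -{1}[t']tensor_reprK retract //.
by move=> n; rewrite map_cat mem_cat orbC => ->.
Qed.

(** * Images, free modules and dual bases *)

Section LinearImage.
Variables (R : pzRingType) (U V : lmodType R) (f : {linear U -> V}).

Definition lin_image : {pred V} := fun y => `[< exists x, y = f x >].

Lemma lin_imageP y : reflect (exists x, y = f x) (y \in lin_image).
Proof. exact: asboolP. Qed.

Lemma lin_image_closed : submod_closed lin_image.
Proof.
split; first by apply/lin_imageP; exists 0; rewrite linear0.
move=> r _ _ /lin_imageP[x ->] /lin_imageP[y ->]; apply/lin_imageP.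
by exists (r *: x + y); rewrite linearP.
Qed.

HB.instance Definition _ := GRing.isSubmodClosed.Build R V lin_image
  (GRing.submod_closed_semi lin_image_closed).

Lemma lin_image_mem x : f x \in lin_image.
Proof. by apply/lin_imageP; exists x. Qed.

Definition onto_image : U -> submod lin_image := fun x => Submod (lin_image_mem x).

Lemma onto_image_linear : linear onto_image.
Proof. by move=> r x y; apply: val_inj; rewrite /= linearP. Qed.

End LinearImage.

(** The free module on countably many generators is realised as the module of
    finitely supported sequences. *)
Section FiniteSupport.
Variable R : pzRingType.

Definition fin_supp : {pred (nat -> R^o)} :=
  fun u => `[< exists n, forall i, (n <= i)%N -> u i = 0 >].

Lemma fin_suppP u :
  reflect (exists n, forall i, (n <= i)%N -> u i = 0) (u \in fin_supp).
Proof. exact: asboolP. Qed.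

Lemma fin_supp_closed : submod_closed fin_supp.
Proof.
split; first by apply/fin_suppP; exists 0%N.
move=> r u v /fin_suppP[m mu] /fin_suppP[n nv]; apply/fin_suppP.
exists (maxn m n) => i; rewrite geq_max => /andP[mi ni].
have -> : (r *: u + v) i = r *: u i + v i by [].
by rewrite mu // nv // addr0 scaler0.
Qed.

HB.instance Definition _ := GRing.isSubmodClosed.Build R (nat -> R^o) fin_supp
  (GRing.submod_closed_semi fin_supp_closed).

Variables (A : lmodType R) (a : nat -> A).

Lemma fin_comb_ex (u : submod fin_supp) :
  exists x : A, exists N, forall n, (N <= n)%N ->
    \sum_(i < n) (submod_val u i : R) *: a i = x.
Proof.
case: u => u uS /=; have /fin_suppP[N uN] := uS.
exists (\sum_(i < N) (u i : R) *: a i), N => n Nn.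
rewrite (big_ord_widen n (fun i => (u i : R) *: a i) Nn).
rewrite [LHS](bigID (fun i : 'I_n => (i < N)%N)) /=.
rewrite [X in _ + X]big1 ?addr0 // => i; rewrite -leqNgt => Ni.
by rewrite uN // scale0r.
Qed.

(** The map from the free module that sends the basis to [a]. *)
Definition fin_comb (u : submod fin_supp) : A := projT1 (cid (fin_comb_ex u)).

Lemma fin_combP (u : submod fin_supp) : exists N, forall n, (N <= n)%N ->
    \sum_(i < n) (submod_val u i : R) *: a i = fin_comb u.
Proof. exact: projT2 (cid (fin_comb_ex u)). Qed.

Lemma fin_comb_linear : linear fin_comb.
Proof.
move=> r u v; have [l lE] := fin_combP (r *: u + v).
have [m mE] := fin_combP u; have [n nE] := fin_combP v.
pose N := (l + m + n)%N.
have nN : (n <= N)%N by rewrite leq_addl.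
have mN : (m <= N)%N by rewrite /N addnAC leq_addl.
have lN : (l <= N)%N by rewrite /N -addnA leq_addr.
rewrite -(lE N lN) -(mE N mN) -(nE N nN).
rewrite scaler_sumr -big_split; apply: eq_bigr => i _ /=.
have -> : (r *: submod_val u + submod_val v) i =
    r *: submod_val u i + submod_val v i by [].
by rewrite scalerDl scalerA.
Qed.

End FiniteSupport.

Lemma countable_seq (T : Type) (G : set T) (x0 : T) :
  countable G -> exists a : nat -> T, forall x, G x -> exists n, a n = x.
Proof.
rewrite /countable; case/pfcard_geP => [->|[g]]; first by exists (fun=> x0).
exists g => x Gx; have [n _ gn] := @surj _ _ _ _ g x Gx.
by exists n.
Qed.

(** Stated through partial sums: these are endomorphisms of finite rank, and
    each element is fixed by almost all of them. *)
Definition dual_basis (R : pzRingType) (A : lmodType R) (a : nat -> A)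
    (f : nat -> {linear A -> R^o}) :=
  forall x, exists N, forall n, (N <= n)%N -> \sum_(i < n) (f i x : R) *: a i = x.

(** The coordinates of a lift of the identity through a surjection from the
    free module on countably many generators form the dual functionals. *)
Lemma projective_dual_basis (R : pzRingType) (A : lmodType R) :
  countably_generated A -> projective A -> exists a f, @dual_basis R A a f.
Proof.
move=> [G G_countable [_ G_gen]] A_proj.
have [a aG] := countable_seq 0 G_countable.
pose g := linear_of (@fin_comb_linear R A a).
have g_onto x : exists u, g u = x.
  have : x \in (lin_image g : submodClosed A).
    apply: G_gen => // y /aG[n <-]; apply/lin_imageP.
    pose d : nat -> R^o := fun i => if i == n then 1 else 0.
    have dS : d \in @fin_supp R.
      by apply/fin_suppP; exists n.+1 => i ni; rewrite /d gtn_eqF.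
    exists (Submod dS) => /=.
    have [N /(_ (N + n.+1)%N (leq_addr _ _)) <-] := fin_combP a (Submod dS).
    have nN : (n < N + n.+1)%N by rewrite addnS ltnS leq_addl.
    rewrite (bigD1 (Ordinal nN)) //= big1 ?addr0 /d ?eqxx ?scale1r // => i.
    by rewrite -val_eqE /= => /negPf ->; rewrite scale0r.
  by case/lin_imageP => u ->; exists u.
have [h hK] := A_proj _ _ g idfun g_onto.
pose f i x : R^o := submod_val (h x) i.
have f_lin i : linear (f i) by move=> r x y; rewrite /f linearP.
exists a, (fun i => linear_of (f_lin i)) => x.
by have [N NP] := fin_combP a (h x); exists N => n /NP ->; exact: hK.
Qed.

(** * Assembling local splittings *)

Lemma eventually_all (T : eqType) (s : seq T) (P : T -> nat -> Prop) :
  (forall x, x \in s -> exists K, forall j, (K <= j)%N -> P x j) ->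
  exists K, forall j, (K <= j)%N -> forall x, x \in s -> P x j.
Proof.
elim: s => [|x s IHs] sP; first by exists 0%N.
have [K KP] := sP x (mem_head x s).
have [|L LP] := IHs; first by move=> y ys; apply: sP; rewrite inE ys orbT.
exists (maxn K L) => j; rewrite geq_max => /andP[Kj Lj] y.
by rewrite inE => /predU1P[->|]; [exact: KP | exact: LP].
Qed.

Lemma iso_pure_image (R : comPzRingType) (A B : lmodType R)
    (iota : {linear A -> B}) :
  (forall s : seq A, exists sigma : {linear B -> A},
      {in s, forall x, sigma (iota x) = x}) ->
  exists N : submodClosed B, pure N /\ module_iso A (submod N).
Proof.
move=> iota_split.
pose to_im := linear_of (onto_image_linear iota).
have im_ex (y : submod (lin_image iota)) : exists x, to_im x = y.
  by case: y => y yN; have /lin_imageP[x xE] := yN; exists x; exact: val_inj.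
pose inv y := projT1 (cid (im_ex y)).
have invK y : to_im (inv y) = y := projT2 (cid (im_ex y)).
exists (lin_image iota : submodClosed B); split.
  apply: locally_split_pure => s.
  have [sigma sigmaK] := iota_split (map inv s).
  exists (to_im \o sigma) => y ys /=.
  have -> : sigma (submod_val y) = inv y.
    by rewrite -{1}(invK y); apply: sigmaK; rewrite map_f.
  exact: invK.
exists to_im; exists inv => // x.
have [sigma sigmaK] := iota_split [:: x; inv (to_im x)].
have sx : sigma (iota x) = x by apply: sigmaK; rewrite mem_head.
have sy : sigma (iota (inv (to_im x))) = inv (to_im x).
  by apply: sigmaK; rewrite !inE eqxx orbT.
rewrite -[LHS]sy -[RHS]sx.
by congr (sigma _); exact: (congr1 submod_val (invK (to_im x))).
Qed.

Section Intertwining.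
Variables (R : comPzRingType) (R_sr1 : stable_rank_one R).
Variables (A B : lmodType R) (a : nat -> A) (f : nat -> {linear A -> R^o}).
Hypothesis af : dual_basis a f.

Definition splits_upto n (phi : {linear A -> B}) (psi : {linear B -> A}) :=
  forall i, (i < n)%N -> psi (phi (a i)) = a i.

Hypothesis A_in_B : forall n, exists phi psi, splits_upto n phi psi.

(** A given partial splitting can be traded for one that reaches further and
    keeps its values: take any splitting that reaches far enough and correct it
    by an automorphism of [B]. *)
Lemma intertwine_step n m phi psi : splits_upto n phi psi ->
  exists phi' psi', splits_upto m phi' psi' /\
    forall i, (i < n)%N -> phi' (a i) = phi (a i).
Proof.
move=> phiK.
have [phi' [psi' phi'K]] := A_in_B (maxn n m).
have [N /(_ N (leqnn N)) aN] : exists K, forall j, (K <= j)%N ->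
    forall i, i \in iota 0 n -> \sum_(l < j) (f l (a i) : R) *: a l = a i.
  by apply: eventually_all => i _; exact: af.
have [g [g' [gK gE]]] :=
  exchange R_sr1 (fun l : 'I_N => a l) (fun l : 'I_N => f l) phi' phi psi' psi.
exists (g \o phi'), (psi' \o g'); split=> i /= im.
  by rewrite gK phi'K // leq_max im orbT.
apply: gE; [by apply: aN; rewrite mem_iota | | exact: phiK].
by rewrite phi'K // leq_max im.
Qed.

(** Iterating the previous step gives maps that are eventually constant on each
    element of [A]. Their limit [iota] inherits from them a left inverse on every
    finite subset. *)
Lemma pure_embedding :
  exists N : submodClosed B, pure N /\ module_iso A (submod N).
Proof.
pose state : Type := (nat * ({linear A -> B} * {linear B -> A}))%type.
pose good (s : state) := splits_upto s.1 s.2.1 s.2.2.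
pose next (s s' : {s | good s}) := (sval s').1 = (sval s).1.+1 /\
  forall i, (i < (sval s).1)%N -> (sval s').2.1 (a i) = (sval s).2.1 (a i).
have nextP s : {s' | next s s'}.
  case: s => [[n [phi psi]] phiK]; apply: cid.
  have [phi' [psi' [phi'K phi'E]]] := intertwine_step n.+1 phiK.
  have good' : good (n.+1, (phi', psi')) by [].
  by exists (exist _ _ good').
have [phi0 [psi0 phi0K]] := A_in_B 0.
have good0 : good (0%N, (phi0, psi0)) by [].
have [F [F0 FS]] := dependent_choice nextP (exist _ _ good0).
pose phi n := (sval (F n)).2.1; pose psi n := (sval (F n)).2.2.
have Fn n : (sval (F n)).1 = n.
  by elim: n => [|n IHn]; [rewrite F0 | have [-> _] := FS n; rewrite IHn].
have phiK n i : (i < n)%N -> psi n (phi n (a i)) = a i.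
  by rewrite -{1}(Fn n); apply: (svalP (F n)).
have phi_stable n i j : (i < n)%N -> (n <= j)%N -> phi j (a i) = phi n (a i).
  move=> ni; elim: j => [|j IHj]; first by rewrite leqn0 => /eqP ->.
  rewrite leq_eqVlt => /predU1P[-> //|nj]; rewrite -IHj //.
  by have [_] := FS j; rewrite Fn; apply; exact: leq_trans ni _.
have lim_ex x : exists y, exists K, forall j, (K <= j)%N ->
    phi j x = y /\ psi j y = x.
  have [N /(_ N (leqnn N)) xN] := af x.
  exists (phi N x), N => j Nj.
  have phijx : phi j x = phi N x.
    rewrite -xN !linear_sum; apply: eq_bigr => i _.
    by rewrite !linearZ /= (phi_stable N).
  split=> //; rewrite -phijx -xN !linear_sum; apply: eq_bigr => i _.
  by rewrite !linearZ /= phiK // (leq_trans _ Nj).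
have [iota iotaP] := choice lim_ex.
have iota_lin : linear iota.
  move=> r x y; have [K1 /(_ _ _)/proj1 E1] := iotaP (r *: x + y).
  have [K2 /(_ _ _)/proj1 E2] := iotaP x.
  have [K3 /(_ _ _)/proj1 E3] := iotaP y.
  pose K := maxn K1 (maxn K2 K3).
  have [k1 k2 k3] : [/\ K1 <= K, K2 <= K & K3 <= K]%N.
    by rewrite !leq_max !leqnn !orbT.
  by rewrite -(E1 K) // -(E2 K) // -(E3 K) // linearP.
apply: (iso_pure_image (iota := linear_of iota_lin)) => s.
have [K KP] := @eventually_all _ s (fun x j => psi j (iota x) = x)
  (fun x _ => let: ex_intro K E := iotaP x in
     ex_intro _ K (fun j Kj => proj2 (E j Kj))).
by exists (psi K) => x; exact: KP.
Qed.

End Intertwining.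

(** * Cancellation *)

Lemma lin_image_fin_gen (R : pzRingType) (V : lmodType R) n
    (h : {linear 'rV[R]_n -> V}) :
  fin_gen (lin_image h).
Proof.
pose G := [set` [seq h (delta_mx 0 i) | i : 'I_n]]%classic.
exists G; first exact: finite_seq.
split=> [x /mapP[i _ ->]|T GT _ /lin_imageP[v ->]]; first exact: lin_image_mem.
rewrite [v]row_sum_delta linear_sum; apply: rpred_sum => i _.
by rewrite linearZ; apply: rpredZ; apply: GT; apply: map_f; rewrite mem_enum.
Qed.

(** Choose [w] in [I] acting as the identity on the finitely generated
    submodule of [I] through which [J] factors. As linear maps commute with the
    action of [w], it acts as the identity on [J] too. *)
Lemma prec_ideal_unit (R : comPzRingType) (I J : submodClosed R^o) :
  pure I -> prec (submod J) (submod I) ->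
  exists2 w : R, w \in I & forall x, x \in J -> w * x = x.
Proof.
move=> I_pure [Y [G /finite_seqP[s ->] [_ Y_gen]] JY].
have [|w wI ws] := @pure_common_unit R I (map submod_val s) I_pure.
  by move=> _ /mapP[y _ ->]; exact: valP.
exists w => // x xJ.
pose T : {pred submod I} := fun y => w *: y == y.
have T_closed : submod_closed T.
  split=> [|r u v]; rewrite !unfold_in ?scaler0 //.
  by move=> /eqP wu /eqP wv; rewrite scalerDr scalerA mulrC -scalerA wu wv.
pose T_mixin := GRing.isSubmodClosed.Build R (submod I) T
  (GRing.submod_closed_semi T_closed).
pose T' : submodClosed (submod I) := HB.pack T T_mixin.
have YT : {subset Y <= T'}.
  apply: Y_gen => y ys; rewrite unfold_in; apply/eqP/val_inj => /=.
  by apply: ws; rewrite map_f.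
pose h (v : 'rV[R]_1) : submod J := v 0 0 *: Submod xJ.
have h_lin : linear h by move=> r u v; rewrite /h !mxE scalerDl scalerA.
have [phi [psi [phiK phiY]]] := JY _ (lin_image_fin_gen (linear_of h_lin)).
pose x1 := onto_image (linear_of h_lin) 1%:M.
have := congr1 submod_val (phiK x1).
have /YT := phiY x1; rewrite unfold_in => /eqP <-; rewrite linearZ phiK /= /h.
by rewrite mxE eqxx scale1r.
Qed.

Section Cancellation.
Variables (R : comPzRingType) (R_sr1 : stable_rank_one R).
Variables (A B : lmodType R) (I J : submodClosed R^o) (J_pure : pure J) (w : R).
Hypotheses (wI : w \in I) (wJ : forall x, x \in J -> w * x = x).
Hypothesis AI_BJ : precsim (A * submod I)%type (B * submod J)%type.

(** Cancellation of the ideals. Let [alpha] and [beta] witness the comparison of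
    [A * I] with [B * J] on the submodule generated by the elements [(a i, 0)]
    and [(0, w)], write [alpha (0, w) = (b0, j)], and let [Q : B -> I] be the
    component of [beta]. Reading off the [I]-component of [beta (alpha (0, w))]
    gives [Q b0 + r j = w] for some [r]. Were [w] equal to [1], this would be
    the usual situation: [j + y Q b0] is a unit for some [y], the shear
    [(b, u) |-> (b, u + y Q b)] of the target turns the entry of [alpha]
    between the ideals into that unit, and Gaussian elimination with it as a pivot leaves
    a split map from [A] to [B].
    In general, [j + (1 - w)] and [Q b0] are still comaximal, because [1 - w]
    annihilates [J]; the resulting unit is the pivot up to the summand [1 - w],
    which does not matter since [w] fixes every element that the elimination
    has to clear. The shear leads out of [B * J], but only elements of [J] have
    to be sheared back, and a single element of [J] fixes finitely many of them. *)
Lemma cancel_ideal N (a : 'I_N -> A) (f : 'I_N -> {linear A -> R^o}) (s : seq A) :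
  {in s, forall x, \sum_i (f i x : R) *: a i = x} ->
  exists (phi : {linear A -> B}) (psi : {linear B -> A}),
    {in s, forall x, psi (phi x) = x}.
Proof.
move=> fa.
pose theta x := \sum_i (f i x : R) *: a i.
pose w1 : submod I := Submod wI.
pose z (v : 'rV[R]_(N + 1)) : A * submod I :=
  (\sum_i lsubmx v 0 i *: a i, rsubmx v 0 0 *: w1).
have z_lin : linear z.
  move=> r u v; congr pair; last by rewrite /= !mxE scalerDl scalerA.
  rewrite /= scaler_sumr -big_split; apply: eq_bigr => i _.
  by rewrite /= !mxE scalerDl scalerA.
have [alpha [beta betaK]] := AI_BJ (lin_image_fin_gen (linear_of z_lin)).
(* [al x r] is the value of [alpha] at [(theta x, r w)]. *)
pose c x r : 'rV[R]_(N + 1) := row_mx (\row_i f i x) (r%:M).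
have zc x r : z (c x r) = (theta x, r *: w1).
  rewrite /z /c row_mxKl row_mxKr mxE eqxx mulr1n; congr (_, _).
  by apply: eq_bigr => i _; rewrite mxE.
pose zz := linear_of (onto_image_linear (linear_of z_lin)).
pose al x r := alpha (zz (c x r)).
have alK x r : beta (al x r) = (theta x, r *: w1) by rewrite /al betaK /= zc.
have al_lin r x y s' t' : al (r *: x + y) (r * s' + t') = r *: al x s' + al y t'.
  rewrite /al; have -> : c (r *: x + y) (r * s' + t') = r *: c x s' + c y t'.
    rewrite /c scale_row_mx add_row_mx; congr row_mx; apply/rowP=> i.
      by rewrite !mxE linearP.
    by rewrite !mxE !ord1 !mulr1n.
  by rewrite !linearP.
have al_linr x r : al x r = al x 0 + r *: al 0 1.
  by rewrite addrC -al_lin scaler0 add0r mulr1 addr0.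
pose Q b : R := submod_val (beta (b, 0)).2.
pose QJ u : R := submod_val (beta (0, u)).2.
have QS b u : Q b + QJ u = submod_val (beta (b, u)).2.
  have -> : (b, u) = (b, 0) + (0, u) by congr pair; rewrite /= (addr0, add0r).
  by rewrite linearD.
have QJ_scale r u : QJ (r *: u) = r * QJ u.
  have -> : QJ (r *: u) = submod_val (beta (r *: (0, u))).2.
    by rewrite /QJ; congr (submod_val (beta (_, _)).2); rewrite scaler0.
  by rewrite linearZ.
have Q_lin r b b' : Q (r *: b + b') = r * Q b + Q b'.
  have -> : Q (r *: b + b') = submod_val (beta (r *: (b, 0) + (b', 0))).2.
    by rewrite /Q; congr (submod_val (beta _).2); congr pair;
      rewrite /= scaler0 addr0.
  by rewrite linearP.
have wQJ u : w * QJ u = QJ u.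
  by rewrite -QJ_scale; congr QJ; apply: val_inj; apply: wJ; exact: valP.
pose b0 := (al 0 1).1; pose j := (al 0 1).2.
have QSw : Q b0 + QJ j = w.
  by rewrite QS -surjective_pairing alK /= [LHS]mul1r.
have jJ : submod_val j \in J by exact: valP.
have [e eJ ej] := pure_local_unit J_pure jJ.
pose e1 : submod J := Submod eJ.
have QJj : QJ j = submod_val j * QJ e1.
  rewrite -QJ_scale; congr QJ; apply: val_inj => /=.
  by rewrite -[LHS]ej [LHS]mulrC.
(* [QJ e1 * e + (1 - e)] is [QJ e1] on the support of [e] and [1] elsewhere,
   which inverts [j + (1 - w)] modulo [Q b0]. *)
have [|y /(_ 1)[t' t'1]] := @R_sr1 (submod_val j + (1 - w)) (Q b0).
  move=> u; exists (u * (QJ e1 * e + (1 - e))), u.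
  rewrite -mulrA -mulrDr -[LHS]mulr1; congr (_ * _).
  have we := wJ eJ.
  have -> : (QJ e1 * e + (1 - e)) * (submod_val j + (1 - w)) + Q b0 =
     QJ e1 * (e * submod_val j) + submod_val j - e * submod_val j
       + QJ e1 * (e - w * e) + 1 - w - e + w * e + Q b0 by ring.
  have -> : Q b0 = w - submod_val j * QJ e1 by rewrite -QSw QJj addrK.
  by rewrite we ej; ring.
(* [d x] is the second component of the sheared value of [alpha] at [x]. *)
pose d x : R := submod_val (al x 0).2 + y * Q (al x 0).1.
have wd x : w * d x = d x.
  have QS0 : Q (al x 0).1 = - QJ (al x 0).2.
    by apply/eqP; rewrite -addr_eq0 QS -surjective_pairing alK /= scale0r.
  rewrite /d QS0 mulrDr wJ; last exact: valP.
  by rewrite mulrCA mulrN wQJ.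
(* Subtracting the pivot column clears [d x]; [gamma] is the first component. *)
pose gamma x : B := (al x 0).1 - (t' * d x) *: b0.
have d_lin r x x' : d (r *: x + x') = r * d x + d x'.
  have alE : al (r *: x + x') 0 = r *: al x 0 + al x' 0.
    by rewrite -al_lin mulr0 addr0.
  have -> : d (r *: x + x') = r * submod_val (al x 0).2 + submod_val (al x' 0).2
      + y * Q (r *: (al x 0).1 + (al x' 0).1) by rewrite /d alE.
  by rewrite Q_lin /d; ring.
have gamma_lin : linear gamma.
  move=> r x x'.
  have -> : gamma (r *: x + x') =
      (r *: al x 0 + al x' 0).1 - (t' * d (r *: x + x')) *: b0.
    by rewrite -al_lin mulr0 addr0.
  rewrite /gamma d_lin scalerBr scalerA addrACA -opprD -scalerDl; congr (_ - _ *: _).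
  by ring.
pose k x := (al x (- (t' * d x))).2.
have al_gamma x : al x (- (t' * d x)) = (gamma x, k x).
  by rewrite [LHS]surjective_pairing; congr pair; rewrite al_linr /= scaleNr.
(* Shearing back [(gamma x, 0)] gives a value of [alpha]. *)
have Qgamma x : y * Q (gamma x) = - submod_val (k x).
  have Qg : Q (gamma x) = Q (al x 0).1 - t' * d x * Q b0.
    have -> : gamma x = (- (t' * d x)) *: b0 + (al x 0).1 by rewrite addrC scaleNr.
    by rewrite Q_lin; ring.
  have kE : submod_val (k x) = submod_val (al x 0).2 - t' * d x * submod_val j.
    by rewrite /k al_linr -[X in _ = _ + X]mulNr.
  rewrite Qg kE.
  have -> : y * (Q (al x 0).1 - t' * d x * Q b0)
     = d x - submod_val (al x 0).2
       - d x * (t' * (submod_val j + (1 - w) + y * Q b0))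
       + t' * d x * submod_val j + t' * (d x - w * d x) by rewrite /d; ring.
  by rewrite -t'1 wd; ring.
have [|v vJ vk] := @pure_common_unit R J [seq submod_val (k x) | x <- s] J_pure.
  by move=> _ /mapP[x _ ->]; exact: valP.
pose delta b : A := (beta (b, (- (y * Q b)) *: (Submod vJ : submod J))).1.
have delta_lin : linear delta.
  move=> r b b'; rewrite /delta; set v1 := Submod vJ.
  have -> : (r *: b + b', - (y * Q (r *: b + b')) *: v1)
     = r *: (b, - (y * Q b) *: v1) + (b', - (y * Q b') *: v1).
    congr pair; rewrite /= scalerA -scalerDl Q_lin; congr (_ *: _); ring.
  by rewrite linearP.
exists (linear_of gamma_lin), (linear_of delta_lin) => x xs /=.
rewrite /delta Qgamma opprK.
have -> : submod_val (k x) *: (Submod vJ : submod J) = k x.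
  by apply: val_inj => /=; rewrite [LHS]mulrC vk //; apply/mapP; exists x.
by rewrite -al_gamma alK; exact: fa.
Qed.

End Cancellation.

Theorem corollary5p15 (R : comPzRingType)
    (R_normal : normal_ring R) (R_sr1 : stable_rank_one R)
    (A B : lmodType R)
    (A_cg : countably_generated A) (A_proj : projective A)
    (B_cg : countably_generated B) (B_proj : projective B)
    (I J : submodClosed R^o)
    (I_pure : pure I) (J_pure : pure J)
    (I_cg : countably_generated (submod I)) (I_proj : projective (submod I))
    (J_cg : countably_generated (submod J)) (J_proj : projective (submod J))
    (AI_BJ : precsim (A * submod I)%type (B * submod J)%type)
    (J_I : prec (submod J) (submod I)) :
  exists N : submodClosed B, pure N /\ module_iso A (submod N).
Proof.
have [w wI wJ] := prec_ideal_unit I_pure J_I.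
have [a [f af]] := projective_dual_basis A_cg A_proj.
apply: (pure_embedding R_sr1 af) => n.
have [N /(_ N (leqnn N)) aN] : exists K, forall j, (K <= j)%N ->
    forall x, x \in [seq a i | i <- iota 0 n] ->
    \sum_(l < j) (f l x : R) *: a l = x.
  by apply: eventually_all => x _; exact: af.
have [phi [psi phiK]] :=
  cancel_ideal R_sr1 J_pure wI wJ AI_BJ (a := fun l : 'I_N => a l)
    (f := fun l : 'I_N => f l) aN.
exists phi, psi => i ni; apply: phiK; apply: map_f.
by rewrite mem_iota.
Qed.
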